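(* For $n\ge 2$, the group $TVP_n$ is generated by the elements $\lambda_{kl}$ ($1\le k\ne l\le n$) and $\gamma_j$ ($1\le j\le n$), and a complete set of defining relations in these generators is: $\lambda_{ij}\lambda_{kl}=\lambda_{kl}\lambda_{ij}$ for pairwise distinct $i,j,k,l$; $\lambda_{ki}\lambda_{kj}\lambda_{ij}=\lambda_{ij}\lambda_{kj}\lambda_{ki}$ for pairwise distinct $i,j,k$; $\gamma_i^2=1$; $\gamma_i\gamma_j=\gamma_j\gamma_i$ for $i\neq j$; $\lambda_{ij}\gamma_k=\gamma_k\lambda_{ij}$ for pairwise distinct $i,j,k$; $\lambda_{ij}=\gamma_i\gamma_j\lambda_{ji}\gamma_j\gamma_i$ for $i\ne j$.
   Context: For $n\ge 2$, the twisted virtual braid group $TVB_n$ is the group with generators $\sigma_1,\dots,\sigma_{n-1}$, $\rho_1,\dots,\rho_{n-1}$, $\gamma_1,\dots,\gamma_n$ and defining relations: $\sigma_i\sigma_{i+1}\sigma_i=\sigma_{i+1}\sigma_i\sigma_{i+1}$ ($1\le i\le n-2$); $\sigma_i\sigma_j=\sigma_j\sigma_i$ ($|i-j|\ge 2$); $\rho_i^2=1$; $\rho_i\rho_j=\rho_j\rho_i$ ($|i-j|\ge2$); $\rho_i\rho_{i+1}\rho_i=\rho_{i+1}\rho_i\rho_{i+1}$ ($1\le i\le n-2$); $\sigma_i\rho_j=\rho_j\sigma_i$ ($|i-j|\ge 2$); $\rho_i\rho_{i+1}\sigma_i=\sigma_{i+1}\rho_i\rho_{i+1}$ ($1\le i\le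 n-2$); $\gamma_i^2=1$ and $\gamma_i\gamma_j=\gamma_j\gamma_i$ (all $i,j$); $\gamma_j\rho_i=\rho_i\gamma_j$ and $\gamma_j\sigma_i=\sigma_i\gamma_j$ for $j\notin\{i,i+1\}$; $\rho_i\gamma_i=\gamma_{i+1}\rho_i$ ($1\le i\le n-1$); $\rho_i\sigma_i\rho_i=\gamma_{i+1}\gamma_i\sigma_i\gamma_i\gamma_{i+1}$ ($1\le i\le n-1$). $\varphi_P:TVB_n\to S_n$ is the homomorphism with $\sigma_i\mapsto(i,i+1)$, $\rho_i\mapsto(i,i+1)$, $\gamma_j\mapsto e$, and the twisted virtual pure braid group is $TVP_n=\ker\varphi_P$. In $TVB_n$ define $\lambda_{i,i+1}=\rho_i\sigma_i^{-1}$, $\lambda_{i+1,i}=\rho_i\lambda_{i,i+1}\rho_i$ ($1\le i\le n-1$), and for $1\le i<j-1\le n-1$: $\lambda_{ij}=\rho_{j-1}\rho_{j-2}\cdots\rho_{i+1}\lambda_{i,i+1}\rho_{i+1}\cdots\rho_{j-2}\rho_{j-1}$, $\lambda_{ji}=\rho_{j-1}\rho_{j-2}\cdots\rho_{i+1}\lambda_{i+1,i}\rho_{i+1}\cdots\rho_{j-2}\rho_{j-1}$. *)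

(* Defs.v *)
(* groups given by presentations are encoded
   via words in letters (generator, exponent sign) and the congruence
   generated by free cancellation and the defining relations. *)
From mathcomp Require Import all_boot.
Set Implicit Arguments. Unset Strict Implicit. Unset Printing Implicit Defensive.

(* a letter (x, true) is x, (x, false) is x^-1 *)
Definition word (X : Type) := seq (X * bool).

(* congruence on words generated by free cancellation and the relations R:
   words modulo [pres_eq R] form the group < X | R >. *)
Inductive pres_eq (X : Type) (R : word X -> word X -> Prop) :
    word X -> word X -> Prop :=
| pe_refl w : pres_eq R w w
| pe_sym u v : pres_eq R u v -> pres_eq R v u
| pe_trans u v w : pres_eq R u v -> pres_eq R v w -> pres_eq R u w
| pe_cat u u' v v' : pres_eq R u u' -> pres_eq R v v' -> pres_eq R (u ++ v) (u' ++ v')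
| pe_cancel x b : pres_eq R [:: (x, b); (x, ~~ b)] [::]
| pe_rel u v : R u v -> pres_eq R u v.

Definition winv (X : Type) (w : word X) : word X :=
  rev (map (fun p => (p.1, ~~ p.2)) w).

Definition wsubst (X Y : Type) (f : X -> word Y) (w : word X) : word Y :=
  flatten (map (fun p => if p.2 then f p.1 else winv (f p.1)) w).

Inductive tvb_gen := sig of nat | rho of nat | gam of nat.

Definition L (x : tvb_gen) : word tvb_gen := [:: (x, true)].
Definition Li (x : tvb_gen) : word tvb_gen := [:: (x, false)].

Definition far (i j : nat) := (i.+2 <= j) || (j.+2 <= i).

Inductive tvb_rel (n : nat) : word tvb_gen -> word tvb_gen -> Prop :=
| r_sbraid i : 1 <= i -> i <= n - 2 ->
    tvb_rel n (L (sig i) ++ L (sig i.+1) ++ L (sig i))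
              (L (sig i.+1) ++ L (sig i) ++ L (sig i.+1))
| r_scomm i j : 1 <= i <= n - 1 -> 1 <= j <= n - 1 -> far i j ->
    tvb_rel n (L (sig i) ++ L (sig j)) (L (sig j) ++ L (sig i))
| r_rsq i : 1 <= i <= n - 1 -> tvb_rel n (L (rho i) ++ L (rho i)) [::]
| r_rcomm i j : 1 <= i <= n - 1 -> 1 <= j <= n - 1 -> far i j ->
    tvb_rel n (L (rho i) ++ L (rho j)) (L (rho j) ++ L (rho i))
| r_rbraid i : 1 <= i -> i <= n - 2 ->
    tvb_rel n (L (rho i) ++ L (rho i.+1) ++ L (rho i))
              (L (rho i.+1) ++ L (rho i) ++ L (rho i.+1))
| r_srcomm i j : 1 <= i <= n - 1 -> 1 <= j <= n - 1 -> far i j ->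
    tvb_rel n (L (sig i) ++ L (rho j)) (L (rho j) ++ L (sig i))
| r_mixed i : 1 <= i -> i <= n - 2 ->
    tvb_rel n (L (rho i) ++ L (rho i.+1) ++ L (sig i))
              (L (sig i.+1) ++ L (rho i) ++ L (rho i.+1))
| r_gsq j : 1 <= j <= n -> tvb_rel n (L (gam j) ++ L (gam j)) [::]
| r_gcomm i j : 1 <= i <= n -> 1 <= j <= n ->
    tvb_rel n (L (gam i) ++ L (gam j)) (L (gam j) ++ L (gam i))
| r_grcomm i j : 1 <= i <= n - 1 -> 1 <= j <= n -> j != i -> j != i.+1 ->
    tvb_rel n (L (gam j) ++ L (rho i)) (L (rho i) ++ L (gam j))
| r_gscomm i j : 1 <= i <= n - 1 -> 1 <= j <= n -> j != i -> j != i.+1 ->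
    tvb_rel n (L (gam j) ++ L (sig i)) (L (sig i) ++ L (gam j))
| r_rg i : 1 <= i <= n - 1 ->
    tvb_rel n (L (rho i) ++ L (gam i)) (L (gam i.+1) ++ L (rho i))
| r_rsr i : 1 <= i <= n - 1 ->
    tvb_rel n (L (rho i) ++ L (sig i) ++ L (rho i))
              (L (gam i.+1) ++ L (gam i) ++ L (sig i) ++ L (gam i) ++ L (gam i.+1)).

Definition tvb_valid_letter (n : nat) (p : tvb_gen * bool) : bool :=
  match p.1 with
  | sig i => (1 <= i) && (i <= n - 1)
  | rho i => (1 <= i) && (i <= n - 1)
  | gam j => (1 <= j) && (j <= n)
  end.
Definition tvb_valid (n : nat) (w : word tvb_gen) := all (tvb_valid_letter n) w.

(* phi_P : TVB_n -> S_n, on words; permutations of {1..n} as maps nat -> nat *)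
Definition transp (i k : nat) : nat :=
  if k == i then i.+1 else if k == i.+1 then i else k.
Definition phiP_letter (x : tvb_gen) : nat -> nat :=
  match x with
  | sig i => transp i
  | rho i => transp i
  | gam _ => id
  end.
(* the image of x_1 ... x_m is phi(x_1) o ... o phi(x_m) (transpositions are involutions) *)
Definition phiP (w : word tvb_gen) : nat -> nat :=
  foldr (fun p f => phiP_letter p.1 \o f) id w.

(* the word w represents an element of TVP_n = ker phi_P *)
Definition in_TVP (n : nat) (w : word tvb_gen) :=
  forall k, 1 <= k <= n -> phiP w k = k.

Definition rho_down (i j : nat) : word tvb_gen :=
  map (fun k => (rho k, true)) (rev (iota i.+1 (j - i.+1))).
Definition rho_up (i j : nat) : word tvb_gen :=
  map (fun k => (rho k, true)) (iota i.+1 (j - i.+1)).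

(* lambda_{i,i+1} = rho_i sigma_i^-1, lambda_{i+1,i} = rho_i lambda_{i,i+1} rho_i *)
Definition lam_up (i : nat) : word tvb_gen := L (rho i) ++ Li (sig i).
Definition lam_dn (i : nat) : word tvb_gen := L (rho i) ++ lam_up i ++ L (rho i).

(* lambda_{kl}; for |k-l| = 1 the rho-strings are empty *)
Definition lam_word (k l : nat) : word tvb_gen :=
  if k < l then rho_down k l ++ lam_up k ++ rho_up k l
  else rho_down l k ++ lam_dn l ++ rho_up l k.

Inductive tvp_gen := lam of nat & nat | gamp of nat.

Definition P (x : tvp_gen) : word tvp_gen := [:: (x, true)].

Definition distinct3 (i j k : nat) := [&& i != j, i != k & j != k].
Definition distinct4 (i j k l : nat) :=
  [&& i != j, i != k, i != l, j != k, j != l & k != l].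
Definition inrange (n i : nat) := (1 <= i) && (i <= n).

Inductive tvp_rel (n : nat) : word tvp_gen -> word tvp_gen -> Prop :=
| t_comm i j k l : inrange n i -> inrange n j -> inrange n k -> inrange n l ->
    distinct4 i j k l ->
    tvp_rel n (P (lam i j) ++ P (lam k l)) (P (lam k l) ++ P (lam i j))
| t_ybe i j k : inrange n i -> inrange n j -> inrange n k -> distinct3 i j k ->
    tvp_rel n (P (lam k i) ++ P (lam k j) ++ P (lam i j))
              (P (lam i j) ++ P (lam k j) ++ P (lam k i))
| t_gsq i : inrange n i -> tvp_rel n (P (gamp i) ++ P (gamp i)) [::]
| t_gcomm i j : inrange n i -> inrange n j -> i != j ->
    tvp_rel n (P (gamp i) ++ P (gamp j)) (P (gamp j) ++ P (gamp i))
| t_lgcomm i j k : inrange n i -> inrange n j -> inrange n k -> distinct3 i j k ->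
    tvp_rel n (P (lam i j) ++ P (gamp k)) (P (gamp k) ++ P (lam i j))
| t_lconj i j : inrange n i -> inrange n j -> i != j ->
    tvp_rel n (P (lam i j))
              (P (gamp i) ++ P (gamp j) ++ P (lam j i) ++ P (gamp j) ++ P (gamp i)).

Definition tvp_valid_letter (n : nat) (p : tvp_gen * bool) : bool :=
  match p.1 with
  | lam k l => [&& inrange n k, inrange n l & k != l]
  | gamp j => inrange n j
  end.
Definition tvp_valid (n : nat) (w : word tvp_gen) := all (tvp_valid_letter n) w.

Definition tvp_to_tvb (x : tvp_gen) : word tvb_gen :=
  match x with
  | lam k l => lam_word k l
  | gamp j => L (gam j)
  end.
Definition embed (w : word tvp_gen) : word tvb_gen := wsubst tvp_to_tvb w.

(* Main.v *)
(** The group presented by the claimed relations carries an action of S_n by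
    permuting indices, so one can form its semidirect product with S_n.  Sending
    rho_i to (1, s_i), sigma_i to (lambda_{i,i+1}^-1, s_i) and gamma_j to
    (gamma_j, 1) respects the relations of TVB_n; its first component [psi] is
    a left inverse of [embed], which shows that no further relations are needed.
    Conversely, conjugation by rho_i permutes the indices of the lambda's and
    gamma's inside TVB_n, so each claimed relation need only be checked
    on the indices 1, 2, 3, 4.  The same fact gives w = embed (psi w) r with r a
    word in the rho's; if w is pure then r has trivial permutation, and r = 1 by
    the Coxeter presentation of S_n. *)
From Stdlib Require Import Setoid Morphisms.
From mathcomp Require Import all_boot zify.
Require Import Defs.
Set Implicit Arguments. Unset Strict Implicit. Unset Printing Implicit Defensive.

(** * Groups given by presentations: rewriting and inverses of words *)

#[local] Instance pres_eq_equiv (X : Type) (R : word X -> word X -> Prop) :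
  Equivalence (pres_eq R).
Proof.
split; [exact: pe_refl | exact: pe_sym | exact: pe_trans].
Qed.

#[local] Instance cat_pres_eq (X : Type) (R : word X -> word X -> Prop) :
  Proper (pres_eq R ==> pres_eq R ==> pres_eq R) (@cat (X * bool)).
Proof. by move=> u u' hu v v' hv; apply: pe_cat. Qed.

#[local] Instance cons_pres_eq (X : Type) (R : word X -> word X -> Prop)
    (p : X * bool) :
  Proper (pres_eq R ==> pres_eq R) (@cons (X * bool) p).
Proof. by move=> v v' hv; apply: (@pe_cat _ R [:: p] [:: p]) => //; apply: pe_refl. Qed.

Lemma cancel_cons (X : Type) (R : word X -> word X -> Prop) x b (t : word X) :
  pres_eq R [:: (x, b), (x, ~~ b) & t] t.
Proof. by rewrite -[X in pres_eq _ _ X]cat0s; apply: (pe_cat (pe_cancel R x b)); apply: pe_refl. Qed.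


Notation "u =b[ n ] v" := (pres_eq (tvb_rel n) u v)
  (at level 70, format "u  =b[ n ]  v").
Notation "u =p[ n ] v" := (pres_eq (tvp_rel n) u v)
  (at level 70, format "u  =p[ n ]  v").

(** Turns a defining relation into a rewriting rule with a free tail [t]. Relations are used in this
    shape below, because on explicit letters a product is a nest of [cons] cells and a rule must
    apply to a prefix of some suffix. *)
Lemma rel_cat (X : Type) (R : word X -> word X -> Prop) u v (t : word X) :
  R u v -> pres_eq R (u ++ t) (v ++ t).
Proof. by move=> h; apply: pe_cat (pe_rel h) (pe_refl _ _). Qed.

Lemma cancel_cons_inv (X : Type) (R : word X -> word X -> Prop) x b (t : word X) :
  pres_eq R [:: (x, ~~ b), (x, b) & t] t.
Proof. by have := cancel_cons R x (~~ b) t; rewrite negbK. Qed.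

Lemma winv_cat (X : Type) (u v : word X) : winv (u ++ v) = winv v ++ winv u.
Proof. by rewrite /winv map_cat rev_cat. Qed.

Lemma winv_cons (X : Type) (p : X * bool) (u : word X) :
  winv (p :: u) = winv u ++ [:: (p.1, ~~ p.2)].
Proof. by rewrite -cat1s winv_cat. Qed.

Lemma winvK (X : Type) : involutive (@winv X).
Proof.
elim=> [|[x b] u IH] //; rewrite winv_cons winv_cat IH /=.
by rewrite /winv /= negbK.
Qed.

Lemma mulwV (X : Type) (R : word X -> word X -> Prop) (u : word X) :
  pres_eq R (u ++ winv u) [::].
Proof.
elim: u => [|[x b] u IH]; first exact: pe_refl.
by rewrite winv_cons /= catA IH; apply: pe_cancel.
Qed.

Lemma mulVw (X : Type) (R : word X -> word X -> Prop) (u : word X) :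
  pres_eq R (winv u ++ u) [::].
Proof. by rewrite -{2}[u]winvK; apply: mulwV. Qed.

Lemma cat_inv_uniq (X : Type) (R : word X -> word X -> Prop) (u v : word X) :
  pres_eq R (u ++ v) [::] -> pres_eq R u (winv v).
Proof.
move=> h; rewrite -[X in pres_eq _ X]cats0 -(mulwV R v) catA h.
exact: pe_refl.
Qed.

#[local] Instance winv_pres_eq (X : Type) (R : word X -> word X -> Prop) :
  Proper (pres_eq R ==> pres_eq R) (@winv X).
Proof.
by move=> u v h; apply: cat_inv_uniq; rewrite -h; apply: mulVw.
Qed.

(** * Conjugation by the generators rho *)

Lemma rho_rho n i t : 0 < i < n -> [:: (rho i, true), (rho i, true) & t] =b[n] t.
Proof. by move=> hi; apply: (rel_cat t (@r_rsq n i _)); lia. Qed.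

Lemma rho_inv n i t : 0 < i < n -> (rho i, false) :: t =b[n] (rho i, true) :: t.
Proof.
move=> hi; rewrite -{1}(rho_rho t hi).
exact: (@cancel_cons_inv _ (tvb_rel n) (rho i) true).
Qed.

Lemma rho_comm n i j t : 0 < i < n -> 0 < j < n -> far i j ->
  [:: (rho i, true), (rho j, true) & t] =b[n] [:: (rho j, true), (rho i, true) & t].
Proof. by move=> hi hj hf; apply: (rel_cat t (@r_rcomm n i j _ _ hf)); lia. Qed.

Lemma rho_braid n i t : 0 < i -> i.+1 < n ->
  [:: (rho i, true), (rho i.+1, true), (rho i, true) & t] =b[n]
  [:: (rho i.+1, true), (rho i, true), (rho i.+1, true) & t].
Proof. by move=> hi hj; apply: (rel_cat t (@r_rbraid n i _ _)); lia. Qed.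

(** Insert the cancelling pair of x before [t], commute its first letter to the left past y, and
    cancel there. *)
Lemma comm_inv (X : Type) (R : word X -> word X -> Prop) (x y : X) (b c : bool) :
  (forall t, pres_eq R [:: (x, b), (y, c) & t] [:: (y, c), (x, b) & t]) ->
  forall t, pres_eq R [:: (x, ~~ b), (y, c) & t] [:: (y, c), (x, ~~ b) & t].
Proof.
move=> h t; rewrite -{1}(@cancel_cons _ R x b t) -h cancel_cons_inv.
exact: pe_refl.
Qed.

Lemma sig_rho_comm n i j b t : 0 < i < n -> 0 < j < n -> far i j ->
  [:: (sig i, b), (rho j, true) & t] =b[n] [:: (rho j, true), (sig i, b) & t].
Proof.
move=> hi hj hf.
have h t' : [:: (sig i, true), (rho j, true) & t'] =b[n]
            [:: (rho j, true), (sig i, true) & t'].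
  by apply: (rel_cat t' (@r_srcomm n i j _ _ hf)); lia.
by case: b; [apply: h | apply: (comm_inv h)].
Qed.

Definition conjrho (i : nat) (x : word tvb_gen) : word tvb_gen :=
  (rho i, true) :: x ++ [:: (rho i, true)].

#[local] Instance conjrho_pres_eq n i :
  Proper (pres_eq (tvb_rel n) ==> pres_eq (tvb_rel n)) (conjrho i).
Proof. by move=> u v h; rewrite /conjrho h; apply: pe_refl. Qed.

Lemma conjrhoK n i x : 0 < i < n -> conjrho i (conjrho i x) =b[n] x.
Proof.
move=> hi; rewrite /conjrho /= -catA /= !rho_rho // cats0.
exact: pe_refl.
Qed.

Lemma conjrho_cat n i x y : 0 < i < n ->
  conjrho i (x ++ y) =b[n] conjrho i x ++ conjrho i y.
Proof.
move=> hi; rewrite /conjrho /= -!catA /= rho_rho //.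
exact: pe_refl.
Qed.

Lemma conjrho_winv n i x : 0 < i < n ->
  conjrho i (winv x) =b[n] winv (conjrho i x).
Proof.
move=> hi; rewrite /conjrho winv_cons winv_cat /= !rho_inv //.
exact: pe_refl.
Qed.

Lemma conjrho_far n i j x : 0 < i < n -> 0 < j < n -> far i j ->
  conjrho i (conjrho j x) =b[n] conjrho j (conjrho i x).
Proof.
move=> hi hj hf; rewrite /conjrho /= -!catA /=.
have hf' : far j i by move: hf; rewrite /far; lia.
by rewrite (rho_comm [::] hj hi hf'); apply: rho_comm.
Qed.

Lemma conjrho_braid n i x : 0 < i -> i.+1 < n ->
  conjrho i (conjrho i.+1 (conjrho i x)) =b[n]
  conjrho i.+1 (conjrho i (conjrho i.+1 x)).
Proof.
move=> hi hj; rewrite /conjrho /= -!catA /=.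
by rewrite (rho_braid [::] hi hj); apply: rho_braid.
Qed.

Lemma conjrho_lam_up_far n i j : 0 < i < n -> 0 < j < n -> far i j ->
  conjrho j (lam_up i) =b[n] lam_up i.
Proof.
move=> hi hj hf; rewrite /conjrho /= sig_rho_comm // -rho_comm // rho_rho //.
exact: pe_refl.
Qed.

Lemma mixed_inv n i t : 0 < i -> i.+1 < n ->
  [:: (rho i, true), (rho i.+1, true), (sig i, false) & t] =b[n]
  [:: (sig i.+1, false), (rho i, true), (rho i.+1, true) & t].
Proof.
move=> hi hj.
rewrite -[X in X =b[n] _](@cancel_cons_inv _ _ (sig i.+1) true).
have h : [:: (rho i, true), (rho i.+1, true), (sig i, true), (sig i, false) & t] =b[n]
   [:: (sig i.+1, true), (rho i, true), (rho i.+1, true), (sig i, false) & t].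
  by apply: (rel_cat _ (@r_mixed n i _ _)); lia.
by rewrite -h (cancel_cons _ (sig i) true); apply: pe_refl.
Qed.

(** The braid relation among the rho's exposes rho_i rho_{i+1} sigma_i^-1; the mixed relation moves
    this pair to the right of sigma_{i+1}^-1, where it cancels. *)
Lemma conjrho_lam_up_shift n i : 0 < i -> i.+1 < n ->
  conjrho i (conjrho i.+1 (lam_up i)) =b[n] lam_up i.+1.
Proof.
move=> hi hj; rewrite /conjrho /=.
rewrite rho_braid // mixed_inv //.
by rewrite !rho_rho; [exact: pe_refl | lia..].
Qed.

(* [lamd true k d] is lambda_{k,k+1+d} and [lamd false k d] is lambda_{k+1+d,k}. *)
Fixpoint lamd (b : bool) (k d : nat) : word tvb_gen :=
  if d is d'.+1 then conjrho (k.+1 + d') (lamd b k d')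
  else if b then lam_up k else lam_dn k.

(** Lengthening the distance by one adds one outermost pair of rho's, which makes induction on [d]
    available for both orientations at once. *)
Lemma lam_wordE b k d :
  (if b then lam_word k (k.+1 + d) else lam_word (k.+1 + d) k) = lamd b k d.
Proof.
rewrite /lam_word; have -> : (k < k.+1 + d) = true by lia.
have -> : (k.+1 + d < k) = false by lia.
rewrite /rho_down /rho_up addKn.
elim: d => [|d IH]; first by case: b.
have -> : iota k.+1 d.+1 = iota k.+1 d ++ [:: k.+1 + d] by rewrite -(addn1 d) iotaD.
rewrite rev_cat !map_cat /= -IH /conjrho.
by case: b {IH}; rewrite /= -!catA.
Qed.

Lemma conjrho_lamd0 n b k : 0 < k < n -> conjrho k (lamd b k 0) =b[n] lamd (~~ b) k 0.
Proof. by move=> hk; case: b => /=; [exact: pe_refl | exact: conjrhoK]. Qed.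

Lemma conjrho_lamd_far n b i k d : 0 < i < n -> 0 < k -> k + d < n ->
  (i.+1 < k) || (k.+1 + d < i) -> conjrho i (lamd b k d) =b[n] lamd b k d.
Proof.
move=> hi hk; elim: d => [|d IH] hd hf.
  have [h1 h2] : 0 < k < n /\ far k i by rewrite /far; lia.
  case: b => /=; first exact: conjrho_lam_up_far.
  rewrite -[lam_dn k]/(conjrho k (lam_up k)) conjrho_far //; last by rewrite /far; lia.
  by rewrite conjrho_lam_up_far //; apply: pe_refl.
by rewrite /= conjrho_far ?IH; [exact: pe_refl | rewrite /far; lia..].
Qed.

(** At distance two this is the shift from k to k+1, with one braid move for the descending
    orientation. Any further outer conjugation is far from k and commutes with rho_k. *)
Lemma conjrho_lamd_left n b k d : 0 < k -> k.+1 + d < n ->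
  conjrho k (lamd b k d.+1) =b[n] lamd b k.+1 d.
Proof.
move=> hk; elim: d => [|d IH] hd.
  rewrite /= addn0; have hn : k.+1 < n by lia.
  case: b => /=; first exact: conjrho_lam_up_shift.
  rewrite -[lam_dn k]/(conjrho k (lam_up k)) conjrho_braid //.
  by rewrite conjrho_lam_up_shift //; apply: pe_refl.
rewrite [lamd b k d.+2]/= conjrho_far; [|lia|lia|by rewrite /far; lia].
rewrite IH; last lia.
by rewrite /= !addSnnS; apply: pe_refl.
Qed.

(** If i is far from the outermost conjugation, induct. Otherwise the two outermost conjugations are
    by rho_{i+1} and rho_i, and a braid move leaves an innermost rho_{i+1} that fixes the shorter
    lambda. *)
Lemma conjrho_lamd_mid n b i k d : 0 < k < i -> i < k + d -> k + d < n ->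
  conjrho i (lamd b k d) =b[n] lamd b k d.
Proof.
move=> hk; elim: d => [|d IH] hid hd; first lia.
have [e|ne] := eqVneq i (k + d); last first.
  by rewrite /= conjrho_far ?IH; [exact: pe_refl | rewrite /far; lia..].
case: d => [|d] in IH hid hd e *; first lia.
have -> : i = k.+1 + d by lia.
rewrite /= addnS conjrho_braid; [|lia|lia].
by rewrite conjrho_lamd_far; [exact: pe_refl | lia..].
Qed.

Lemma transpL i : transp i i = i.+1.
Proof. by rewrite /transp eqxx. Qed.

Lemma transpR i : transp i i.+1 = i.
Proof. by rewrite /transp eqxx; case: eqP => //; lia. Qed.

Lemma transpD i k : k != i -> k != i.+1 -> transp i k = k.
Proof. by rewrite /transp => /negbTE -> /negbTE ->. Qed.

(** The cases are the positions of i relative to the ends k and k+1+d: away from both, at the upper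
    end (the recursion itself), just below the lower end, at the lower end, just below the upper end
    (undoing the recursion), and strictly between. *)
Lemma conjrho_lamd n b i k d : 0 < i < n -> 0 < k -> k + d < n ->
  conjrho i (lamd b k d) =b[n]
  (if b then lam_word (transp i k) (transp i (k.+1 + d))
   else lam_word (transp i (k.+1 + d)) (transp i k)).
Proof.
move=> hi hk hd.
have [h|h] := boolP ((i.+1 < k) || (k.+1 + d < i)).
  by rewrite !transpD ?lam_wordE; [exact: conjrho_lamd_far | lia..].
have [h1|h1] := eqVneq i (k.+1 + d).
  rewrite transpD ?h1; [|lia|lia].
  by rewrite -h1 transpL h1 -addnS lam_wordE; apply: pe_refl.
have [h2|h2] := eqVneq i.+1 k.
  subst k; rewrite transpR transpD; [|lia|lia].
  rewrite addSnnS lam_wordE -conjrho_lamd_left ?conjrhoK; [|lia..].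
  exact: pe_refl.
have [h3|h3] := eqVneq i k.
  subst k; rewrite transpL; case: d => [|d] in hd h h1 *.
    by rewrite addn0 transpR conjrho_lamd0 // -lam_wordE addn0; case: b; apply: pe_refl.
  rewrite transpD; [|lia|lia].
  by rewrite conjrho_lamd_left -1?addSnnS ?lam_wordE; [apply: pe_refl|lia..].
rewrite (@transpD i k); [|lia|lia].
have [h4|h4] := eqVneq i (k + d).
  case: d => [|d] in hd h h1 h4 *; first lia.
  have -> : k.+1 + d.+1 = i.+1 by lia.
  have ei : i = k.+1 + d by lia.
  by rewrite transpR ei lam_wordE conjrhoK; [apply: pe_refl|lia].
by rewrite transpD ?lam_wordE; [apply: conjrho_lamd_mid|..]; lia.
Qed.

Lemma conjrho_lam_word n i k l : 0 < i < n -> inrange n k -> inrange n l -> k != l ->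
  conjrho i (lam_word k l) =b[n] lam_word (transp i k) (transp i l).
Proof.
rewrite /inrange => hi hk hl hkl; case: (ltngtP k l) => h.
- have [d e] : exists d, l = k.+1 + d by exists (l - k.+1); lia.
  subst l; have := @conjrho_lamd n true i k d hi.
  by rewrite -lam_wordE; apply; lia.
- have [d e] : exists d, k = l.+1 + d by exists (k - l.+1); lia.
  subst k; have := @conjrho_lamd n false i l d hi.
  by rewrite -lam_wordE; apply; lia.
- by rewrite h eqxx in hkl.
Qed.

Lemma gam_rho_comm n i j t : 0 < i < n -> inrange n j -> j != i -> j != i.+1 ->
  [:: (gam j, true), (rho i, true) & t] =b[n] [:: (rho i, true), (gam j, true) & t].
Proof. by move=> hi hj h1 h2; apply: (rel_cat t (@r_grcomm n i j _ hj h1 h2)); lia. Qed.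

Lemma rho_gam n i t : 0 < i < n ->
  [:: (rho i, true), (gam i, true) & t] =b[n] [:: (gam i.+1, true), (rho i, true) & t].
Proof. by move=> hi; apply: (rel_cat t (@r_rg n i _)); lia. Qed.

Lemma conjrho_gam n i j : 0 < i < n -> inrange n j ->
  conjrho i (L (gam j)) =b[n] L (gam (transp i j)).
Proof.
move=> hi hj; rewrite /transp; case: eqVneq => [->|h1].
  by rewrite /conjrho /= rho_gam // rho_rho //; apply: pe_refl.
case: eqVneq => [->|h2].
  by rewrite /conjrho /= -rho_gam // rho_rho //; apply: pe_refl.
by rewrite /conjrho /= gam_rho_comm // rho_rho //; apply: pe_refl.
Qed.

(** * The action of permutations on words in the generators of TVP *)

Definition actg (f : nat -> nat) (x : tvp_gen) : tvp_gen :=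
  match x with lam k l => lam (f k) (f l) | gamp j => gamp (f j) end.

Definition act (f : nat -> nat) (u : word tvp_gen) : word tvp_gen :=
  map (fun p => (actg f p.1, p.2)) u.

(** Injectivity is global, so that distinctness of indices transfers without range conditions;
    products of transpositions satisfy it. *)
Definition perm_on (n : nat) (f : nat -> nat) :=
  injective f /\ forall k, inrange n k -> inrange n (f k).

Lemma perm_on_id n : perm_on n id. Proof. by split=> // x y. Qed.

Lemma perm_on_comp n f g : perm_on n f -> perm_on n g -> perm_on n (f \o g).
Proof.
move=> [f1 f2] [g1 g2]; split; first exact: inj_comp.
by move=> k hk; apply/f2/g2.
Qed.

Lemma transpK i : involutive (transp i).
Proof. by move=> k; rewrite /transp; repeat (case: eqP => //); lia. Qed.

Lemma perm_on_transp n i : 0 < i < n -> perm_on n (transp i).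
Proof.
move=> hi; split; first exact: (can_inj (transpK i)).
by move=> k; rewrite /transp /inrange; repeat case: eqP; lia.
Qed.

Lemma act_comp f g u : act (f \o g) u = act f (act g u).
Proof. by rewrite /act -map_comp; apply: eq_map => -[[k l|j] b]. Qed.

Lemma eq_act f g u : f =1 g -> act f u = act g u.
Proof. by move=> h; apply: eq_map => -[[k l|j] b] /=; rewrite !h. Qed.

Lemma act_id u : act id u = u.
Proof. by rewrite /act -[RHS]map_id; apply: eq_map => -[[k l|j] b]. Qed.

Lemma act_cat f u v : act f (u ++ v) = act f u ++ act f v.
Proof. exact: map_cat. Qed.

Lemma act_valid n f u : perm_on n f -> tvp_valid n u -> tvp_valid n (act f u).
Proof.
move=> [f1 f2] hu; rewrite /tvp_valid /act all_map; apply: sub_all hu => -[[k l|j] b].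
  by move=> /and3P[hk hl hkl]; apply/and3P; split; rewrite ?f2 // inj_eq.
exact: f2.
Qed.

Lemma act_pres_eq n f u v : perm_on n f -> u =p[n] v -> act f u =p[n] act f v.
Proof.
move=> [f1 f2]; elim=> {u v}.
- by move=> w; apply: pe_refl.
- by move=> u v _ h; apply: pe_sym.
- by move=> u v w _ h1 _; apply: pe_trans.
- by move=> u u' v v' _ h _ h'; rewrite !act_cat; apply: pe_cat.
- by move=> x b; apply: pe_cancel.
move=> u v h; apply: pe_rel; case: h => *.
all: constructor; rewrite /distinct3 /distinct4 ?inj_eq //; exact: f2.
Qed.

Lemma embed_cons p u : embed (p :: u) =
  (if p.2 then tvp_to_tvb p.1 else winv (tvp_to_tvb p.1)) ++ embed u.
Proof. by []. Qed.

Lemma embed_cat u v : embed (u ++ v) = embed u ++ embed v.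
Proof. by rewrite /embed /wsubst map_cat flatten_cat. Qed.

(** Conjugation respects products and inverses, so the index action of s_i on single generators
    extends to all words. *)
Lemma conjrho_embed n i u : 0 < i < n -> tvp_valid n u ->
  conjrho i (embed u) =b[n] embed (act (transp i) u).
Proof.
move=> hi; elim: u => [|[x b] u IH]; first by move=> _; apply: rho_rho.
move=> /andP[hx hu]; rewrite [act _ _]/= !embed_cons conjrho_cat //.
rewrite IH //; apply: pe_cat (pe_refl _ _) => /=.
have h : conjrho i (tvp_to_tvb x) =b[n] tvp_to_tvb (actg (transp i) x).
  case: x hx => [k l /and3P[hk hl hkl]|j hj]; last exact: conjrho_gam.
  exact: conjrho_lam_word.
by case: b {hx}; rewrite ?conjrho_winv // h; apply: pe_refl.
Qed.

(** * Permutations realised by words in the rho's *)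

Definition rhos (r : seq nat) : word tvb_gen := map (fun k => (rho k, true)) r.

Definition idx_valid (n : nat) (r : seq nat) := all (fun i => 0 < i < n) r.

Lemma phiP_cat u v : phiP (u ++ v) =1 phiP u \o phiP v.
Proof. by move=> k; elim: u => //= p u IH; rewrite IH. Qed.

Lemma perm_on_rhos n r : idx_valid n r -> perm_on n (phiP (rhos r)).
Proof.
elim: r => [_|i r IH /andP[hi hr]]; first exact: perm_on_id.
by apply: (perm_on_comp (perm_on_transp hi) (IH hr)).
Qed.

Lemma conjrhos_embed n r u v : idx_valid n r -> tvp_valid n u -> tvp_valid n v ->
  embed u =b[n] embed v ->
  embed (act (phiP (rhos r)) u) =b[n] embed (act (phiP (rhos r)) v).
Proof.
move=> + hu hv huv; elim: r => [_|i r IH /andP[hi hr]]; first by rewrite !act_id.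
have hp := perm_on_rhos hr.
rewrite ![act (phiP (rhos (i :: r))) _](act_comp (transp i)).
by rewrite -!(conjrho_embed hi) ?act_valid // IH //; apply: pe_refl.
Qed.

Lemma phiP_iota_fix a d k : (k < a) || (a + d < k) -> phiP (rhos (iota a d)) k = k.
Proof.
elim: d a => //= d IH a h; rewrite IH; last lia.
by rewrite /transp; repeat case: eqP; lia.
Qed.

Lemma phiP_iota_last a d : phiP (rhos (iota a d)) (a + d) = a.
Proof.
elim: d a => [|d IH] a; first by rewrite addn0.
by rewrite /= -addSnnS IH /transp; repeat case: eqP; lia.
Qed.

Lemma phiP_rev_rhos r k : phiP (rhos (rev r)) (phiP (rhos r) k) = k.
Proof.
elim: r k => //= i r IH k.
by rewrite rev_cons /rhos -cats1 map_cat phiP_cat /= transpK; apply: IH.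
Qed.

Lemma phiP_rhos_rev r k : phiP (rhos r) (phiP (rhos (rev r)) k) = k.
Proof. by have := phiP_rev_rhos (rev r) k; rewrite revK. Qed.

(** Multiple transitivity of S_n, by adding entries at the end. Let r place the old entries and let
    y be the preimage of the new entry under r. Precomposing r with a cycle that takes the next
    position to y leaves the earlier positions alone. *)
Lemma rhos_transitive n xs : uniq xs -> all (inrange n) xs ->
  exists2 r, idx_valid n r &
    forall m, m < size xs -> phiP (rhos r) m.+1 = nth 0 xs m.
Proof.
elim/last_ind: xs => [|xs x IH]; first by exists [::].
rewrite rcons_uniq all_rcons => /andP[hx hu] /andP[hin hall].
have [r hr hphi] := IH hu hall.
have hr' : idx_valid n (rev r) by rewrite /idx_valid all_rev.
have := (perm_on_rhos hr').2 x hin.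
have := phiP_rhos_rev r x; set y := phiP (rhos (rev r)) x => ey hy.
(* A smaller y would be a position already filled, so x would occur in [xs]. Entries are counted
   from 0 and positions from 1. *)
have ysize : size xs < y.
  rewrite ltnNge; apply/negP => hle; case/negP: hx.
  have e : y = y.-1.+1 by move: hy; rewrite /inrange; lia.
  have hlt : y.-1 < size xs by lia.
  by rewrite -ey e hphi // mem_nth.
pose s := iota (size xs).+1 (y - (size xs).+1).
exists (r ++ rev s).
  rewrite /idx_valid all_cat all_rev (hr : all _ r) /=.
  by apply/allP => i; rewrite mem_iota; move: hy; rewrite /inrange; lia.
move=> m; rewrite size_rcons ltnS /rhos map_cat phiP_cat /= leq_eqVlt.
case/orP => [/eqP->|hm].
  rewrite nth_rcons ltnn eqxx -ey; congr (phiP _ _).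
  have := phiP_iota_last (size xs).+1 (y - (size xs).+1); rewrite subnKC // => e.
  by rewrite -[in LHS]e; apply: phiP_rev_rhos.
rewrite nth_rcons hm -hphi //; congr (phiP _ _).
have e : phiP (rhos s) m.+1 = m.+1 by apply: phiP_iota_fix; rewrite ltnS hm.
by rewrite -[in LHS]e; apply: phiP_rev_rhos.
Qed.

(** * The relations of TVP hold in TVB *)

Lemma sig_inv_comm n i j t : 0 < i < n -> 0 < j < n -> far i j ->
  [:: (sig i, false), (sig j, false) & t] =b[n] [:: (sig j, false), (sig i, false) & t].
Proof.
move=> hi hj hf; apply: (@comm_inv _ _ (sig i) (sig j) true false) => {}t.
symmetry; apply: (@comm_inv _ _ (sig j) (sig i) true true) => {}t.
by symmetry; apply: (rel_cat t (@r_scomm n i j _ _ hf)); lia.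
Qed.

Lemma sig_inv_braid n i t : 0 < i -> i.+1 < n ->
  [:: (sig i, false), (sig i.+1, false), (sig i, false) & t] =b[n]
  [:: (sig i.+1, false), (sig i, false), (sig i.+1, false) & t].
Proof.
move=> hi hj; have hk : i <= n - 2 by lia.
exact: (pe_cat (winv_pres_eq (pe_rel (r_sbraid hi hk))) (pe_refl _ t)).
Qed.

(** Multiply [mixed_inv] by rho_{i+1} rho_i on both sides. *)
Lemma mixed_inv' n i t : 0 < i -> i.+1 < n ->
  [:: (sig i, false), (rho i.+1, true), (rho i, true) & t] =b[n]
  [:: (rho i.+1, true), (rho i, true), (sig i.+1, false) & t].
Proof.
move=> hi hj; have [hi' hj'] : 0 < i < n /\ 0 < i.+1 < n by lia.
rewrite -{2}(rho_rho t hi') -{2}(rho_rho ((rho i, true) :: t) hj').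
by rewrite -mixed_inv // !rho_rho //; apply: pe_refl.
Qed.

Lemma gam_gam n j t : inrange n j -> [:: (gam j, true), (gam j, true) & t] =b[n] t.
Proof. by move=> hj; apply: (rel_cat t (r_gsq hj)). Qed.

Lemma gam_inv n j t : inrange n j -> (gam j, false) :: t =b[n] (gam j, true) :: t.
Proof.
move=> hj; rewrite -{1}(gam_gam t hj).
exact: (@cancel_cons_inv _ (tvb_rel n) (gam j) true).
Qed.

Lemma gam_comm n i j t : inrange n i -> inrange n j ->
  [:: (gam i, true), (gam j, true) & t] =b[n] [:: (gam j, true), (gam i, true) & t].
Proof. by move=> hi hj; apply: (rel_cat t (r_gcomm hi hj)). Qed.

Lemma gam_sig_inv_comm n i j t : 0 < i < n -> inrange n j -> j != i -> j != i.+1 ->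
  [:: (sig i, false), (gam j, true) & t] =b[n] [:: (gam j, true), (sig i, false) & t].
Proof.
move=> hi hj h1 h2; apply: (@comm_inv _ _ (sig i) (gam j) true true) => {}t.
by symmetry; apply: (rel_cat t (@r_gscomm n i j _ hj h1 h2)); lia.
Qed.

Lemma rho_gam_succ n i t : 0 < i < n ->
  [:: (rho i, true), (gam i.+1, true) & t] =b[n] [:: (gam i, true), (rho i, true) & t].
Proof.
move=> hi; rewrite -[X in _ =b[n] X](rho_rho _ hi) (rho_gam _ hi) (rho_rho _ hi).
exact: pe_refl.
Qed.

Lemma embed_lam_comm n : 4 <= n ->
  embed (P (lam 1 2) ++ P (lam 3 4)) =b[n] embed (P (lam 3 4) ++ P (lam 1 2)).
Proof.
move=> hn; rewrite /embed /wsubst /=.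
have [h1 h3] : 0 < 1 < n /\ 0 < 3 < n by lia.
rewrite (sig_rho_comm _ _ h1 h3) // (rho_comm _ h1 h3) // sig_inv_comm //.
by rewrite -(sig_rho_comm _ _ h3 h1) //; apply: pe_refl.
Qed.

(** Collecting the rho's on the left by the mixed relation turns both sides into rho_2 rho_1 rho_2
    followed by one side of the braid relation for sigma_1^-1 and sigma_2^-1. *)
Lemma embed_lam_ybe n : 3 <= n ->
  embed (P (lam 1 2) ++ P (lam 1 3) ++ P (lam 2 3)) =b[n]
  embed (P (lam 2 3) ++ P (lam 1 3) ++ P (lam 1 2)).
Proof.
move=> hn; rewrite /embed /wsubst /=.
have [h1 h2] : 0 < 1 < n /\ 0 < 2 < n by lia.
rewrite (rho_rho _ h2) !(@mixed_inv' n 1) // -(@rho_braid n 1) // (rho_rho _ h1).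
by rewrite -(@mixed_inv n 1) // rho_braid // -sig_inv_braid //; apply: pe_refl.
Qed.

Lemma embed_lam_gam n : 3 <= n ->
  embed (P (lam 1 2) ++ P (gamp 3)) =b[n] embed (P (gamp 3) ++ P (lam 1 2)).
Proof.
move=> hn; rewrite /embed /wsubst /=.
have [h1 h3] : 0 < 1 < n /\ inrange n 3 by rewrite /inrange; lia.
by rewrite gam_sig_inv_comm // gam_rho_comm //; apply: pe_refl.
Qed.

(** On the right-hand side the last rho_1 passes through the gamma's to the end. What stands before
    it is the inverse of one side of [r_rsr], hence rho_1 sigma_1^-1 rho_1. *)
Lemma embed_lam_conj n : 2 <= n ->
  embed (P (lam 1 2)) =b[n]
  embed (P (gamp 1) ++ P (gamp 2) ++ P (lam 2 1) ++ P (gamp 2) ++ P (gamp 1)).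
Proof.
move=> hn; rewrite /embed /wsubst /=.
have [h1 g1 g2] : [/\ 0 < 1 < n, inrange n 1 & inrange n 2].
  by rewrite /inrange; split; lia.
have hrel : [:: (rho 1, true); (sig 1, false); (rho 1, true)] =b[n]
    [:: (gam 2, true); (gam 1, true); (sig 1, false); (gam 1, true); (gam 2, true)].
  have h : 1 <= 1 <= n - 1 by lia.
  have := winv_pres_eq (pe_rel (r_rsr h)); rewrite /winv /rev /=.
  by rewrite !(rho_inv _ h1) !(gam_inv _ g1) !(gam_inv _ g2).
rewrite (rho_rho _ h1) (rho_gam_succ _ h1) (rho_gam _ h1) (gam_comm _ g1 g2).
have := pe_cat hrel (pe_refl (tvb_rel n) [:: (rho 1, true)]).
by rewrite /= (rho_rho _ h1).
Qed.

Lemma size_inrange n xs : uniq xs -> all (inrange n) xs -> size xs <= n.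
Proof.
move=> hu /allP h; rewrite -[n in _ <= n](size_iota 1).
apply: uniq_leq_size hu _ => x /h; rewrite /inrange mem_iota; lia.
Qed.

(** Both sides of a relation are functions of an index map: the identity gives the model relation on
    1, 2, ..., and a permutation taking these to the entries of [xs] gives the general instance. *)
Lemma embed_transport n xs (u v : (nat -> nat) -> word tvp_gen) :
  uniq xs -> all (inrange n) xs ->
  (forall f, act f (u id) = u f) -> (forall f, act f (v id) = v f) ->
  tvp_valid n (u id) -> tvp_valid n (v id) -> embed (u id) =b[n] embed (v id) ->
  exists2 f, embed (u f) =b[n] embed (v f) &
    forall m, m < size xs -> f m.+1 = nth 0 xs m.
Proof.
move=> hx hin hu hv vu vv h; have [r hr hphi] := rhos_transitive hx hin.
by exists (phiP (rhos r)) => //; rewrite -hu -hv; apply: conjrhos_embed.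
Qed.

Lemma embed_rel n u v : tvp_rel n u v -> embed u =b[n] embed v.
Proof.
case=> {u v}.
- move=> i j k l hi hj hk hl.
  have hin : all (inrange n) [:: i; j; k; l] by rewrite /= hi hj hk hl.
  case/and5P=> ij ik il jk /andP[jl kl].
  have hu : uniq [:: i; j; k; l] by rewrite /= !inE !negb_or ij ik il jk jl kl.
  have hn := size_inrange hu hin.
  have [||f + hf] := @embed_transport n _
    (fun f => P (lam (f 1) (f 2)) ++ P (lam (f 3) (f 4)))
    (fun f => P (lam (f 3) (f 4)) ++ P (lam (f 1) (f 2)))
    hu hin (fun=> erefl) (fun=> erefl) _ _ (embed_lam_comm hn).
  + by rewrite /tvp_valid /= /tvp_valid_letter /inrange /=; move: hn; rewrite /=; lia.
  + by rewrite /tvp_valid /= /tvp_valid_letter /inrange /=; move: hn; rewrite /=; lia.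
  by rewrite (hf 0) // (hf 1) // (hf 2) // (hf 3).
- move=> i j k hi hj hk /and3P[ij ik jk].
  (* The model has its common first index equal to 1, so k comes first. *)
  have hin : all (inrange n) [:: k; i; j] by rewrite /= hi hj hk.
  have hu : uniq [:: k; i; j] by rewrite /= !inE !negb_or ij (eq_sym k i) (eq_sym k) ik jk.
  have hn := size_inrange hu hin.
  have [||f + hf] := @embed_transport n _
    (fun f => P (lam (f 1) (f 2)) ++ P (lam (f 1) (f 3)) ++ P (lam (f 2) (f 3)))
    (fun f => P (lam (f 2) (f 3)) ++ P (lam (f 1) (f 3)) ++ P (lam (f 1) (f 2)))
    hu hin (fun=> erefl) (fun=> erefl) _ _ (embed_lam_ybe hn).
  + by rewrite /tvp_valid /= /tvp_valid_letter /inrange /=; move: hn; rewrite /=; lia.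
  + by rewrite /tvp_valid /= /tvp_valid_letter /inrange /=; move: hn; rewrite /=; lia.
  by rewrite (hf 0) // (hf 1) // (hf 2).
- by move=> i hi; apply: (gam_gam [::] hi).
- by move=> i j hi hj _; apply: (gam_comm [::] hi hj).
- move=> i j k hi hj hk /and3P[ij ik jk].
  have hin : all (inrange n) [:: i; j; k] by rewrite /= hi hj hk.
  have hu : uniq [:: i; j; k] by rewrite /= !inE !negb_or ij ik jk.
  have hn := size_inrange hu hin.
  have [||f + hf] := @embed_transport n _
    (fun f => P (lam (f 1) (f 2)) ++ P (gamp (f 3)))
    (fun f => P (gamp (f 3)) ++ P (lam (f 1) (f 2)))
    hu hin (fun=> erefl) (fun=> erefl) _ _ (embed_lam_gam hn).
  + by rewrite /tvp_valid /= /tvp_valid_letter /inrange /=; move: hn; rewrite /=; lia.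
  + by rewrite /tvp_valid /= /tvp_valid_letter /inrange /=; move: hn; rewrite /=; lia.
  by rewrite (hf 0) // (hf 1) // (hf 2).
- move=> i j hi hj ij.
  have hin : all (inrange n) [:: i; j] by rewrite /= hi hj.
  have hu : uniq [:: i; j] by rewrite /= !inE ij.
  have hn := size_inrange hu hin.
  have [||f + hf] := @embed_transport n _
    (fun f => P (lam (f 1) (f 2)))
    (fun f => P (gamp (f 1)) ++ P (gamp (f 2)) ++ P (lam (f 2) (f 1)) ++
              P (gamp (f 2)) ++ P (gamp (f 1)))
    hu hin (fun=> erefl) (fun=> erefl) _ _ (embed_lam_conj hn).
  + by rewrite /tvp_valid /= /tvp_valid_letter /inrange /=; move: hn; rewrite /=; lia.
  + by rewrite /tvp_valid /= /tvp_valid_letter /inrange /=; move: hn; rewrite /=; lia.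
  by rewrite (hf 0) // (hf 1).
Qed.

Lemma embed_pres_eq n u v : u =p[n] v -> embed u =b[n] embed v.
Proof.
elim=> {u v}.
- by move=> w; apply: pe_refl.
- by move=> u v _ h; apply: pe_sym.
- by move=> u v w _ h1 _; apply: pe_trans.
- by move=> u u' v v' _ h _ h'; rewrite !embed_cat; apply: pe_cat.
- move=> x b; rewrite !embed_cons cats0.
  by case: b => /=; [apply: mulwV | apply: mulVw].
- exact: embed_rel.
Qed.

(** * The Coxeter presentation of the symmetric group *)

Lemma phiP_pres_eq n u v : u =b[n] v -> phiP u =1 phiP v.
Proof.
elim=> {u v} //.
- by move=> u v _ h k; rewrite h.
- by move=> u v w _ h1 _ h2 k; rewrite h1.
- by move=> u u' v v' _ h _ h' k; rewrite !phiP_cat /= h h'.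
- by move=> [i|i|i] b k //=; rewrite transpK.
move=> u v [] {u v} /=.
all: rewrite /far => *; move=> k //=; rewrite ?transpK //.
all: by rewrite /transp; repeat (case: eqP => //=); lia.
Qed.

Lemma rho_rhos_comm n i s t : 0 < i < n -> idx_valid n s -> all (far i) s ->
  (rho i, true) :: rhos s ++ t =b[n] rhos s ++ (rho i, true) :: t.
Proof.
move=> hi; elim: s => [|j s IH] /=; first by move=> _ _; apply: pe_refl.
move=> /andP[hj hs] /andP[fj fs]; rewrite rho_comm // IH //.
exact: pe_refl.
Qed.

Lemma rhos_cat r s : rhos (r ++ s) = rhos r ++ rhos s.
Proof. exact: map_cat. Qed.

(* s_i s_k ... s_m = s_k ... s_m s_{i-1} for k < i <= m, with i = k + a + 1 *)
Lemma rho_iota_slide n k a b t : 0 < k -> k + a + b.+1 < n ->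
  (rho (k + a).+1, true) :: rhos (iota k (a + b.+2)) ++ t =b[n]
  rhos (iota k (a + b.+2)) ++ (rho (k + a), true) :: t.
Proof.
move=> hk hn; rewrite iotaD rhos_cat -!catA /=.
have hfar s : s = iota k a \/ s = iota (k + a).+2 b -> idx_valid n s.
  by case=> ->; apply/allP => i; rewrite mem_iota; lia.
rewrite rho_rhos_comm; [|lia|by apply: hfar; left|]; last first.
  by apply/allP => i; rewrite mem_iota /far; lia.
rewrite -rho_braid; [|lia|lia].
rewrite rho_rhos_comm; [|lia|by apply: hfar; right|]; last first.
  by apply/allP => i; rewrite mem_iota /far; lia.
exact: pe_refl.
Qed.

(** The words s_k ... s_m represent the cosets of the subgroup generated by s_1, ..., s_{m-1}, with
    k = m+1 for the empty word. A new s_i on the left commutes past the representative (i+1 < k),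
    extends it (i+1 = k), cancels its first letter (i = k), or slides through it and becomes s_{i-1}
    (i > k). *)
Lemma rhos_coset n m r : m < n -> idx_valid m.+1 r ->
  exists k r', [/\ 0 < k <= m.+1, idx_valid m r' &
    rhos r =b[n] rhos (iota k (m.+1 - k)) ++ rhos r'].
Proof.
move=> hm; elim: r => [_|i r IH /andP[hi /IH [k [r' [hk hr' e]]]]].
  by exists m.+1, [::]; rewrite subnn; split => //; [lia | apply: pe_refl].
case: (ltngtP i k) => hik.
- have [ek|nk] := eqVneq i.+1 k.
    exists i, r'; split => //; first lia.
    have -> : m.+1 - i = (m.+1 - k).+1 by lia.
    by rewrite /= ek e; apply: pe_refl.
  exists k, (i :: r'); split => //; first by apply/andP; split => //; lia.
  rewrite /= e rho_rhos_comm; [exact: pe_refl|lia|..].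
    by apply/allP => j; rewrite mem_iota; lia.
  by apply/allP => j; rewrite mem_iota /far; lia.
- exists k, (i.-1 :: r'); split => //; first by apply/andP; split => //; lia.
  have [a ea] : exists a, i = (k + a).+1 by exists (i - k).-1; lia.
  have em : m.+1 - k = a + (m - i).+2 by lia.
  rewrite /= e em ea /=; apply: rho_iota_slide; lia.
- subst i; exists k.+1, r'; split => //; first lia.
  have ek : m.+1 - k = (m.+1 - k.+1).+1 by lia.
  rewrite /= e ek /= rho_rho; last lia.
  exact: pe_refl.
Qed.

(** In the coset form the subgroup part fixes m+1 and s_k ... s_m sends m+1 to k. A trivial
    permutation thus forces k = m+1, and the word drops to the smaller subgroup. *)
Lemma rhos_trivial n m r : m <= n -> idx_valid m r ->
  (forall k, inrange n k -> phiP (rhos r) k = k) -> rhos r =b[n] [::].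
Proof.
elim: m r => [|m IH] r hm hr hphi.
  by case: r hr {hphi} => [_|i r]; [apply: pe_refl | rewrite /idx_valid /=; lia].
have [k [r' [hk hr' e]]] := rhos_coset hm hr.
have hfix : phiP (rhos r') m.+1 = m.+1.
  elim: r' hr' {e} => //= i s IHs /andP[hi hs]; rewrite IHs //.
  by rewrite /transp; repeat case: eqP; lia.
have ek : k = m.+1.
  have hin : inrange n m.+1 by rewrite /inrange; lia.
  rewrite -[RHS](hphi _ hin) (phiP_pres_eq e) phiP_cat /= hfix.
  have := phiP_iota_last k (m.+1 - k); rewrite subnKC; last lia.
  by move=> ->.
move: e; rewrite ek subnn /= => e.
rewrite e; apply: IH hr' _; first lia.
by move=> j hj; rewrite -(phiP_pres_eq e); apply: hphi.
Qed.

(** * The crossed homomorphism from TVB to TVP *)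

(* The images in TVP x| S_n: sigma_i = lambda_{i,i+1}^-1 rho_i and
   sigma_i^-1 = rho_i lambda_{i,i+1} = lambda_{i+1,i} rho_i. *)
Definition psi_letter (p : tvb_gen * bool) : word tvp_gen :=
  match p with
  | (sig i, true) => [:: (lam i i.+1, false)]
  | (sig i, false) => [:: (lam i.+1 i, true)]
  | (rho _, _) => [::]
  | (gam j, b) => [:: (gamp j, b)]
  end.

(** First component of the product of the letter images in the semidirect product; the second
    component is [phiP]. *)
Fixpoint psi (w : word tvb_gen) : word tvp_gen :=
  if w is p :: w' then psi_letter p ++ act (phiP_letter p.1) (psi w') else [::].

Lemma psi_cat u v : psi (u ++ v) = psi u ++ act (phiP u) (psi v).
Proof.
elim: u => [|p u IH] /=; first by rewrite act_id.
by rewrite IH act_cat -act_comp catA.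
Qed.

Lemma perm_on_phiP n w : tvb_valid n w -> perm_on n (phiP w).
Proof.
elim: w => [_|[x b] w IH /andP[hx hw]]; first exact: perm_on_id.
apply: perm_on_comp (IH hw); case: x hx => [i|i|j] hx /=.
- by apply: perm_on_transp; move: hx; rewrite /tvb_valid_letter /=; lia.
- by apply: perm_on_transp; move: hx; rewrite /tvb_valid_letter /=; lia.
- exact: perm_on_id.
Qed.

Lemma tvb_rel_valid n u v : tvb_rel n u v -> tvb_valid n u /\ tvb_valid n v.
Proof.
case=> {u v} *; rewrite /tvb_valid /= /tvb_valid_letter /=; split; lia.
Qed.

(** A cancelling pair is kept or erased as a whole, and the defining relations contain only letters
    in range. *)
Lemma filter_pres_eq n u v : u =b[n] v ->
  filter (tvb_valid_letter n) u =b[n] filter (tvb_valid_letter n) v.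
Proof.
elim=> {u v}.
- by move=> w; apply: pe_refl.
- by move=> u v _ h; apply: pe_sym.
- by move=> u v w _ h1 _; apply: pe_trans.
- by move=> u u' v v' _ h _ h'; rewrite !filter_cat; apply: pe_cat.
- move=> x b /=; rewrite -[tvb_valid_letter n (x, ~~ b)]/(tvb_valid_letter n (x, b)).
  by case: (tvb_valid_letter n _); [apply: pe_cancel | apply: pe_refl].
move=> u v h; have [/all_filterP -> /all_filterP ->] := tvb_rel_valid h.
exact: pe_rel.
Qed.

Lemma gamp_inv n j t : inrange n j -> (gamp j, false) :: t =p[n] (gamp j, true) :: t.
Proof.
move=> hj; have h : [:: (gamp j, true), (gamp j, true) & t] =p[n] t.
  exact: (rel_cat t (t_gsq hj)).
by rewrite -{1}h; apply: (@cancel_cons_inv _ (tvp_rel n) (gamp j) true).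
Qed.

Lemma psi_rel n u v : tvb_rel n u v -> psi u =p[n] psi v.
Proof.
case=> {u v} /=.
- move=> i hi hn; rewrite !transpL !transpR.
  rewrite !(@transpD i i.+2) ?(@transpD i.+1 i); try lia.
  rewrite transpL transpR.
  have [h1 h2 h3] : [/\ inrange n i.+1, inrange n i.+2 & inrange n i].
    by rewrite /inrange; split; lia.
  (* The images of the two sides are the inverses of the two sides of [t_ybe], whose common first
     index is here i. *)
  have h : distinct3 i.+1 i.+2 i by rewrite /distinct3; lia.
  by symmetry; apply: (winv_pres_eq (pe_rel (t_ybe h1 h2 h3 h))).
- move=> i j hi hj hf.
  have [h1 h2 h3 h4] : [/\ inrange n i, inrange n i.+1, inrange n j & inrange n j.+1].
    by rewrite /inrange; split; lia.
  have h : distinct4 i i.+1 j j.+1 by move: hf; rewrite /far /distinct4; lia.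
  rewrite !transpD; try by move: hf; rewrite /far; lia.
  by symmetry; apply: (winv_pres_eq (pe_rel (t_comm h1 h2 h3 h4 h))).
- by move=> *; apply: pe_refl.
- by move=> *; apply: pe_refl.
- by move=> *; apply: pe_refl.
- move=> i j hi hj hf; rewrite !transpD; try by move: hf; rewrite /far; lia.
  exact: pe_refl.
- move=> i hi hn; rewrite !transpL (@transpD i.+1 i) ?transpL; try lia.
  rewrite (@transpD i i.+2); try lia.
  exact: pe_refl.
- by move=> j hj; apply: pe_rel; apply: t_gsq.
- move=> i j hi hj; have [->|ij] := eqVneq i j; first exact: pe_refl.
  by apply: pe_rel; apply: t_gcomm.
- by move=> i j hi hj h1 h2; rewrite transpD //; apply: pe_refl.
- move=> i j hi hj h1 h2; rewrite transpD //.
  have [hi1 hi2] : inrange n i /\ inrange n i.+1 by rewrite /inrange; lia.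
  have h : distinct3 i i.+1 j by rewrite /distinct3; lia.
  symmetry; apply: (@comm_inv _ _ (lam i i.+1) (gamp j) true true) => t.
  exact: (rel_cat t (t_lgcomm hi1 hi2 hj h)).
- by move=> i hi; rewrite transpL; apply: pe_refl.
- move=> i hi; rewrite transpL transpR.
  have [hi1 hi2] : inrange n i /\ inrange n i.+1 by rewrite /inrange; lia.
  have ij : i.+1 != i by lia.
  have := winv_pres_eq (pe_rel (t_lconj hi2 hi1 ij)); rewrite /winv /rev /=.
  move=> ->; rewrite !(gamp_inv _ hi1) !(gamp_inv _ hi2).
  have ji : i != i.+1 by lia.
  (* The action of s_i has exchanged the two gamma's that follow sigma_i; commutativity restores
     their order. *)
  have h : [:: (gamp i, true); (gamp i.+1, true)] =p[n]
           [:: (gamp i.+1, true); (gamp i, true)] by apply/pe_rel/t_gcomm.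
  by rewrite h; apply: pe_refl.
Qed.

(* A derivation may pass through words with out-of-range letters, whose
   transpositions do not preserve {1..n}; such letters are erased first. *)
Lemma psi_filter_pres_eq n u v : u =b[n] v ->
  psi (filter (tvb_valid_letter n) u) =p[n] psi (filter (tvb_valid_letter n) v).
Proof.
elim=> {u v}.
- by move=> w; apply: pe_refl.
- by move=> u v _ h; apply: pe_sym.
- by move=> u v w _ h1 _; apply: pe_trans.
- move=> u u' v v' hu h _ h'; rewrite !filter_cat !psi_cat h.
  apply: pe_cat (pe_refl _ _) _.
  rewrite (eq_act _ (phiP_pres_eq (filter_pres_eq hu))).
  by apply: act_pres_eq h'; apply/perm_on_phiP/filter_all.
- move=> x b /=; rewrite -[tvb_valid_letter n (x, ~~ b)]/(tvb_valid_letter n (x, b)).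
  case: (tvb_valid_letter n _); last exact: pe_refl.
  case: x b => [i|i|j] [] /=; rewrite ?transpL ?transpR.
  + exact: (pe_cancel _ _ false).
  + exact: (pe_cancel _ _ true).
  + exact: pe_refl.
  + exact: pe_refl.
  + exact: (pe_cancel _ _ true).
  + exact: (pe_cancel _ _ false).
move=> u v h; have [/all_filterP -> /all_filterP ->] := tvb_rel_valid h.
exact: psi_rel.
Qed.

Lemma psi_pres_eq n u v : tvb_valid n u -> tvb_valid n v -> u =b[n] v ->
  psi u =p[n] psi v.
Proof. by move=> /all_filterP {2}<- /all_filterP {2}<-; apply: psi_filter_pres_eq. Qed.

(** * [psi] as a left inverse of [embed] *)

Lemma lamdP n b k d : 0 < k -> k + d < n ->
  [/\ tvb_valid n (lamd b k d), phiP (lamd b k d) =1 id &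
    psi (lamd b k d) = P (if b then lam k (k.+1 + d) else lam (k.+1 + d) k)].
Proof.
move=> hk; elim: d => [|d IH] hd.
  rewrite addn0; split.
  - by case: b; rewrite /tvb_valid /= /tvb_valid_letter /=; lia.
  - by case: b => j /=; rewrite !transpK.
  - by case: b; rewrite /= ?(transpL, transpR).
have [|v p e] := IH; first lia.
split.
- by rewrite /tvb_valid /= all_cat (v : all _ _) /= /tvb_valid_letter /=; lia.
- by move=> j; rewrite /= phiP_cat /= p transpK.
(* The outer rho's contribute no letter; the left one acts by raising the index k+1+d by one and
   fixing k. *)
- rewrite /= psi_cat e /= /act /=.
  by case: b {IH v p e}; rewrite /= addnS transpL transpD //; lia.
Qed.

Lemma tvp_to_tvbP n x b : tvp_valid_letter n (x, b) ->
  [/\ tvb_valid n (tvp_to_tvb x), phiP (tvp_to_tvb x) =1 id &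
    psi (tvp_to_tvb x) = P x].
Proof.
case: x => [k l /and3P[]|j hj]; last by split=> //; rewrite /tvb_valid /= andbT.
rewrite /inrange => hk hl hkl; rewrite /tvp_to_tvb.
case: (ltngtP k l) => h.
- have [d e] : exists d, l = k.+1 + d by exists (l - k.+1); lia.
  by subst l; rewrite (lam_wordE true); apply: (@lamdP n true); lia.
- have [d e] : exists d, k = l.+1 + d by exists (k - l.+1); lia.
  by subst k; rewrite (lam_wordE false); apply: (@lamdP n false); lia.
- by rewrite h eqxx in hkl.
Qed.

Lemma winv_valid n w : tvb_valid n (winv w) = tvb_valid n w.
Proof. by rewrite /tvb_valid /winv all_rev all_map; apply: eq_all => -[]. Qed.

Lemma embedP n u : tvp_valid n u ->
  [/\ tvb_valid n (embed u), phiP (embed u) =1 id & psi (embed u) =p[n] u].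
Proof.
elim: u => [_|[x b] u IH /andP[hx /IH [v p e]]]; first by split=> //; apply: pe_refl.
rewrite embed_cons; set w := if _ then _ else _.
have [vx px ex] := tvp_to_tvbP hx.
have pVx : phiP (winv (tvp_to_tvb x)) =1 id.
  move=> k; have := phiP_pres_eq (mulwV (tvb_rel n) (tvp_to_tvb x)) k.
  by rewrite phiP_cat /= px.
have [vw pw ew] : [/\ tvb_valid n w, phiP w =1 id & psi w =p[n] [:: (x, b)]].
  rewrite /w; case: b {hx w} => /=; first by rewrite ex; split=> //; apply: pe_refl.
  split; rewrite ?winv_valid //.
  (* On words with trivial permutation [psi] is multiplicative, so its value on the inverse follows
     from its value on the word times its inverse. *)
  apply: (@cat_inv_uniq _ _ _ (P x)).
  have := psi_pres_eq _ _ (mulVw (tvb_rel n) (tvp_to_tvb x)).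
  rewrite psi_cat (eq_act _ pVx) act_id ex; apply => //.
  by rewrite /tvb_valid all_cat -!/(tvb_valid _ _) winv_valid vx.
split; first by rewrite /tvb_valid all_cat -!/(tvb_valid _ _) vw.
- by move=> k; rewrite phiP_cat /= pw p.
- by rewrite psi_cat (eq_act _ pw) act_id ew e; apply: pe_refl.
Qed.

(** * Factoring a word into a pure part and a word in the rho's *)

Definition perm_idx (w : word tvb_gen) : seq nat :=
  flatten (map (fun p => match p.1 with sig i | rho i => [:: i] | gam _ => [::] end) w).

Lemma phiP_perm_idx w : phiP (rhos (perm_idx w)) =1 phiP w.
Proof. by move=> k; elim: w => [|[[i|i|j] b] w IH] //=; rewrite IH. Qed.

Lemma rho_embed n i u t : 0 < i < n -> tvp_valid n u ->
  (rho i, true) :: embed u ++ t =b[n] embed (act (transp i) u) ++ (rho i, true) :: t.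
Proof.
move=> hi hu; rewrite -conjrho_embed // /conjrho /= -catA /= rho_rho //.
exact: pe_refl.
Qed.

(** Write the first letter as sigma_i = lambda_{i,i+1}^-1 rho_i or sigma_i^-1 = lambda_{i+1,i}
    rho_i. Moving rho_i to the right through the embedded pure part applies s_i to its indices,
    which is the recursion of [psi]. The permutation part is kept as a word so that [rhos_trivial]
    can be applied to it. *)
Lemma psi_decomp n w : tvb_valid n w ->
  [/\ tvp_valid n (psi w), idx_valid n (perm_idx w) &
    w =b[n] embed (psi w) ++ rhos (perm_idx w)].
Proof.
elim: w => [_|[x b] w IH /andP[hx /IH [v1 v2 e]]]; first by split=> //; apply: pe_refl.
have hi i : x = sig i \/ x = rho i -> 0 < i < n.
  by move: hx; rewrite /tvb_valid_letter /= => + [] h; rewrite h; lia.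
case: x => [i|i|j] in hx hi *.
- have {}hi : 0 < i < n by apply: hi; left.
  have va := act_valid (perm_on_transp hi) v1.
  split.
  + case: b hx => _ /=; rewrite /tvp_valid /= -/(tvp_valid n _) va andbT;
    by rewrite /tvp_valid_letter /inrange /=; lia.
  + by apply/andP.
  have eu : lam_word i i.+1 = lam_up i by rewrite -{2}(addn0 i) (lam_wordE true i 0).
  have ed : lam_word i.+1 i = lam_dn i by rewrite -{1}(addn0 i.+1) (lam_wordE false i 0).
  rewrite {1}e [psi _]/= embed_cat -catA.
  rewrite [perm_idx (_ :: _)]/= [rhos (_ :: _)]/= -/(rhos _) -rho_embed //.
  case: b {hx} => /=; rewrite embed_cons /= ?eu ?ed /=.
    by rewrite rho_inv // rho_rho //; apply: pe_refl.
  by rewrite !rho_rho //; apply: pe_refl.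
- have {}hi : 0 < i < n by apply: hi; right.
  split; [exact: act_valid (perm_on_transp hi) v1 | by apply/andP |].
  rewrite {1}e [psi _]/= [perm_idx (_ :: _)]/= [rhos (_ :: _)]/= -/(rhos _).
  rewrite -rho_embed //.
  by case: b {hx}; rewrite ?rho_inv //; apply: pe_refl.
- rewrite [psi _]/= act_id; split => //; first by apply/andP.
  by rewrite embed_cons {1}e; case: b {hx}; apply: pe_refl.
Qed.

Theorem mainTheorem2 (n : nat) : 2 <= n ->
  (* the lambda_{kl} and gamma_j lie in TVP_n *)
  (forall u : word tvp_gen, tvp_valid n u -> in_TVP n (embed u)) /\
  (* they generate TVP_n *)
  (forall w : word tvb_gen, tvb_valid n w -> in_TVP n w ->
     exists u : word tvp_gen, tvp_valid n u /\ pres_eq (tvb_rel n) (embed u) w) /\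
  (* the listed relations form a complete set of defining relations *)
  (forall u v : word tvp_gen, tvp_valid n u -> tvp_valid n v ->
     (pres_eq (tvb_rel n) (embed u) (embed v) <-> pres_eq (tvp_rel n) u v)).
Proof.
move=> _; split; first by move=> u hu k _; have [_ -> _] := embedP hu.
split.
  move=> w hw hP; have [v1 v2 e] := psi_decomp hw.
  exists (psi w); split => //.
  rewrite [X in _ =b[n] X]e (rhos_trivial (leqnn n) v2) ?cats0; first exact: pe_refl.
  by move=> k hk; rewrite phiP_perm_idx; apply: hP.
move=> u v hu hv; split; last exact: embed_pres_eq.
have [vu _ eu] := embedP hu; have [vv _ ev] := embedP hv.
by move=> /(psi_pres_eq vu vv); rewrite eu ev.
Qed.
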